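(* Let $n \ge 2$ and let $\mathcal{O} \subset F_n$ be a subset contained in the union of finitely many $\mathrm{Aut}(F_n)$-orbits. Then there exist an integer $d \ge 1$ and a representation (group homomorphism) $\rho\colon F_n \to \mathrm{GL}_d(\mathbb{Z})$ with infinite image such that every element of $\rho(\mathcal{O})$ has finite order.
   Context: $F_n$ is the free group on $n$ generators, and $\mathrm{Aut}(F_n)$ acts on the set $F_n$ in the natural way. *)

(* Defs.v *)
From HB Require Import structures.
From mathcomp Require Import all_boot all_order all_fingroup all_algebra.
From mathcomp Require Import boolp classical_sets functions cardinality.

Set Implicit Arguments.
Unset Strict Implicit.
Unset Printing Implicit Defensive.

Section Words.
Variable n : nat.

(* (i, false) stands for the i-th generator and (i, true) for its inverse. *)
Definition letter : Type := ('I_n * bool)%type.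

Implicit Types (a b : letter) (u v w : seq letter).

Definition linv a : letter := (a.1, ~~ a.2).

Definition reduced w : bool := sorted (fun a b => b != linv a) w.

(* Left multiplication of a reduced word by a letter, with cancellation. *)
Definition cons_letter a w : seq letter :=
  if w is b :: w' then if b == linv a then w' else a :: w else [:: a].

Definition word_mul u v : seq letter := foldr cons_letter v u.

Definition word_inv u : seq letter := rev (map linv u).

Lemma linvK : involutive linv.
Proof. by case=> i s; rewrite /linv /= negbK. Qed.

Lemma reduced_tail a w : reduced (a :: w) -> reduced w.
Proof. exact: path_sorted. Qed.

Lemma cons_letter_reduced a w : reduced w -> reduced (cons_letter a w).
Proof.
case: w => [|b w] //= rw; case: eqP => [_|/eqP nab]; first exact: path_sorted rw.
by rewrite /reduced /= nab.
Qed.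

Lemma cons_letter_id a w : reduced (a :: w) -> cons_letter a w = a :: w.
Proof. by case: w => [|b w] //= /andP[/negPf->]. Qed.

Lemma cons_letterK a w : reduced w ->
  cons_letter a (cons_letter (linv a) w) = w.
Proof.
case: w => [|b w] rw /=; first by rewrite eqxx.
rewrite linvK; case: eqP => [<-|_] /=; last by rewrite eqxx.
exact: cons_letter_id.
Qed.

Lemma word_mul_reduced u v : reduced v -> reduced (word_mul u v).
Proof. by move=> rv; elim: u => //= a u; apply: cons_letter_reduced. Qed.

Lemma word_mul_cons_letter a u v : reduced v ->
  word_mul (cons_letter a u) v = cons_letter a (word_mul u v).
Proof.
move=> rv; case: u => [|b u] //=; case: eqP => [->|_] //=.
by rewrite cons_letterK // word_mul_reduced.
Qed.

Lemma word_mulA u v w : reduced w ->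
  word_mul u (word_mul v w) = word_mul (word_mul u v) w.
Proof.
by move=> rw; elim: u => //= a u ->; rewrite word_mul_cons_letter.
Qed.

Lemma word_mul1 u : reduced u -> word_mul u [::] = u.
Proof.
elim: u => //= a u IH ru; rewrite IH; last exact: reduced_tail ru.
exact: cons_letter_id.
Qed.

Lemma word_inv_reduced u : reduced u -> reduced (word_inv u).
Proof.
rewrite /reduced /word_inv rev_sorted sorted_map; apply: sub_sorted => a b /=.
by apply: contra => /eqP ->; rewrite !linvK.
Qed.

Lemma word_invK : involutive word_inv.
Proof. by move=> u; rewrite /word_inv map_rev revK (mapK linvK). Qed.

Lemma word_mulVw u : word_mul (word_inv u) u = [::].
Proof.
elim: u => //= a u IH.
by rewrite /word_inv /= rev_cons /word_mul foldr_rcons /= linvK eqxx.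
Qed.

End Words.

(* The free group on n generators, realised by reduced words. *)
Record free_group (n : nat) : Type := FreeGroup {
  free_word :> seq (letter n);
  free_wordP : reduced free_word
}.

HB.instance Definition _ n := [isSub for @free_word n].
HB.instance Definition _ n := [Choice of free_group n by <:].

Section FreeGroupLaws.
Variable n : nat.
Implicit Types x y z : free_group n.

Definition free_mul x y : free_group n :=
  FreeGroup (word_mul_reduced x (free_wordP y)).
Definition free_one : free_group n := @FreeGroup n [::] isT.
Definition free_inv x : free_group n :=
  FreeGroup (word_inv_reduced (free_wordP x)).

Fact free_mulA : associative free_mul.
Proof. by move=> x y z; apply/val_inj/word_mulA/free_wordP. Qed.
Fact free_mul1g : left_id free_one free_mul.
Proof. by move=> x; apply/val_inj. Qed.
Fact free_mulg1 : right_id free_one free_mul.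
Proof. by move=> x; apply/val_inj/word_mul1/free_wordP. Qed.
Fact free_mulVg : left_inverse free_one free_inv free_mul.
Proof. by move=> x; apply/val_inj/word_mulVw. Qed.
Fact free_mulgV : right_inverse free_one free_inv free_mul.
Proof.
by move=> x; apply/val_inj; rewrite /= -{1}(word_invK x) word_mulVw.
Qed.

HB.instance Definition _ := isGroup.Build (free_group n)
  free_mulA free_mul1g free_mulg1 free_mulVg free_mulgV.

Definition free_gen (i : 'I_n) : free_group n :=
  @FreeGroup n [:: (i, false)] isT.

End FreeGroupLaws.

(* Between groups, the morphisms preserving products and 1 are the group
   homomorphisms; the library develops their theory under this name. *)
Notation group_hom G H := (UMagmaMorphism.type G%type H%type).

Section UniversalProperty.
Local Open Scope group_scope.
Variables (n : nat) (G : groupType).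

Section Lift.
Variable f : 'I_n -> G.

Definition letter_eval (a : letter n) : G := if a.2 then (f a.1)^-1 else f a.1.

Definition free_lift (x : free_group n) : G :=
  foldr (fun a g => letter_eval a * g) 1 (free_word x).

Fact free_liftM : {morph free_lift : x y / x * y}.
Proof.
move=> [u ru] [v rv]; rewrite /free_lift /= {ru rv}.
elim: u => [|a u IH] /=; first by rewrite mul1g.
rewrite -mulgA -IH; case: (word_mul u v) => //= b w.
case: eqP => [->|_] //=; rewrite mulgA -[LHS]mul1g; congr (_ * _).
by case: a => i [] /=; rewrite /letter_eval /= ?mulVg ?mulgV.
Qed.

HB.instance Definition _ :=
  isUMagmaMorphism.Build (free_group n) G free_lift (erefl, free_liftM).

Lemma free_lift_gen i : free_lift (free_gen i) = f i.
Proof. by rewrite /free_lift /= mulg1. Qed.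

End Lift.

Lemma free_lift_unique (phi psi : group_hom (free_group n) G) :
  (forall i, phi (free_gen i) = psi (free_gen i)) -> phi =1 psi.
Proof.
move=> eq_gen [w rw]; elim: w rw => [|a w IH] rw.
  have -> : FreeGroup rw = 1 by apply: val_inj.
  by rewrite !gmulf1.
have rw' := reduced_tail rw.
have -> : FreeGroup rw =
    (if a.2 then (free_gen a.1)^-1 else free_gen a.1) * FreeGroup rw'.
  by apply: val_inj; case: a rw => i [] rw; exact: esym (cons_letter_id rw).
by rewrite !gmulfM IH; congr (_ * _); case: ifP => _; rewrite ?gmulfV eq_gen.
Qed.

End UniversalProperty.

(* GL_d(R), as a possibly infinite group; the library's 'GL_d[R] requires R
   to be finite. *)
Record GL (d : nat) (R : comUnitRingType) : Type := GLMatrix {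
  GL_mx :> 'M[R]_d;
  GL_unit : GL_mx \in unitmx
}.

HB.instance Definition _ d R := [isSub for @GL_mx d R].
HB.instance Definition _ d R := [Choice of GL d R by <:].

Section GeneralLinearGroup.
Local Open Scope ring_scope.
Variables (d : nat) (R : comUnitRingType).
Implicit Types A B : GL d R.

Fact GL_mul_unit A B : GL_mx A *m GL_mx B \in unitmx.
Proof. by rewrite unitmx_mul !GL_unit. Qed.
Fact GL_inv_unit A : invmx (GL_mx A) \in unitmx.
Proof. by rewrite unitmx_inv GL_unit. Qed.

Definition GL_mul A B : GL d R := GLMatrix (GL_mul_unit A B).
Definition GL_one : GL d R := GLMatrix (unitmx1 R d).
Definition GL_inv A : GL d R := GLMatrix (GL_inv_unit A).

Fact GL_mulA : associative GL_mul.
Proof. by move=> A B C; apply/val_inj/mulmxA. Qed.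
Fact GL_mul1g : left_id GL_one GL_mul.
Proof. by move=> A; apply/val_inj/mul1mx. Qed.
Fact GL_mulg1 : right_id GL_one GL_mul.
Proof. by move=> A; apply/val_inj/mulmx1. Qed.
Fact GL_mulVg : left_inverse GL_one GL_inv GL_mul.
Proof. by move=> A; apply/val_inj/mulVmx/GL_unit. Qed.
Fact GL_mulgV : right_inverse GL_one GL_inv GL_mul.
Proof. by move=> A; apply/val_inj/mulmxV/GL_unit. Qed.

HB.instance Definition _ := isGroup.Build (GL d R)
  GL_mulA GL_mul1g GL_mulg1 GL_mulVg GL_mulgV.

End GeneralLinearGroup.

Definition finite_order (G : groupType) (x : G) : Prop :=
  exists2 k : nat, (0 < k)%N & (x ^+ k = 1)%g.

(* The orbit of x under the natural action of Aut(G). *)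
Definition aut_orbit (G : groupType) (x : G) : set G :=
  [set y | exists2 phi : group_hom G G, bijective phi & phi x = y]%classic.

(* Main.v *)
Require Import Defs.
From HB Require Import structures.
From mathcomp Require Import all_boot all_order all_fingroup all_algebra.
From mathcomp Require Import finfield mxtens.
From mathcomp Require Import boolp classical_sets functions cardinality.

Set Implicit Arguments.
Unset Strict Implicit.
Unset Printing Implicit Defensive.

(* It suffices to find a lattice V on which F_n acts through a finite group so
   that no element of the given orbits, enlarged by the orbit of a generator,
   fixes a nonzero vector.  Then for every cocycle c with values in V the affine
   representation g |-> (v |-> g v + c(g)) sends those elements to torsion, and
   when c kills that generator but not another one it has no fixed point, so its
   image is infinite.

   For the orbit of a single x <> 1, choose a prime p and let r be the depth of
     x
   in the p-Zassenhaus filtration, which is the same for the whole orbit.  If F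
   has p^N elements with N = p^j large, and theta in F satisfies no equation of
   small degree over the prime field, send the i-th generator to a unitriangular
   matrix of size rN + 1 over F whose superdiagonal consists of N blocks of
   length r, block b carrying the p^b-th powers of theta^(i n^l), l < r.  For y
   in the orbit, the (rb, rb + r) entry of y - 1 is a^(p^b), where a <> 0 is the
   value at theta of the leading Magnus term of y, and y^N = 1 + Norm(a)
     E_{0,rN}
   is a nontrivial power of the central element z = 1 + E_{0,rN} of order p.  In
   the permutation representation on F^(rN+1) no element of the orbit fixes a
   nonzero vector of the image of 1 - z.

   Several orbits are treated with distinct primes, taking tensor products. *)

Import GRing.Theory.
Local Open Scope ring_scope.

(** * Magnus coefficients *)

Lemma free_group_ind n (P : free_group n -> Prop) :
    P 1%g -> (forall i g, P g -> P (free_gen i * g)%g) ->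
    (forall i g, P g -> P ((free_gen i)^-1 * g)%g) ->
  forall g, P g.
Proof.
move=> P1 Pg Pv [w rw]; elim: w rw => [|a w IH] rw.
  by have -> : FreeGroup rw = 1%g by apply: val_inj.
have rw' := reduced_tail rw.
have -> : FreeGroup rw =
    ((if a.2 then (free_gen a.1)^-1 else free_gen a.1) * FreeGroup rw')%g.
  by apply: val_inj; case: a rw => i [] rw; exact: esym (cons_letter_id rw).
by case: ifP => _; [apply: Pv | apply: Pg]; apply: IH.
Qed.

Section MagnusAction.
Variable n : nat.
Implicit Types (f : seq 'I_n -> int) (g : free_group n) (w : seq 'I_n).

(** Functions on words are noncommutative power series; this is left multiplication by 1 + X_i, and
    [mul_gen_inv] is its inverse. *)
Definition mul_gen (i : 'I_n) f w : int :=
  f w + (if w is j :: w' then if j == i then f w' else 0 else 0).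

Fixpoint mul_gen_inv (i : 'I_n) f w : int :=
  f w - (if w is j :: w' then if j == i then mul_gen_inv i f w' else 0 else 0).

Definition mul_letter (a : letter n) f : seq 'I_n -> int :=
  if a.2 then mul_gen_inv a.1 f else mul_gen a.1 f.

Lemma mul_genK i f : mul_gen i (mul_gen_inv i f) = f.
Proof.
apply/funext => -[|j w]; rewrite /mul_gen /= ?subr0 ?addr0 //.
by case: eqP => _; rewrite ?subrK // subr0 addr0.
Qed.

Lemma mul_gen_invK i f : mul_gen_inv i (mul_gen i f) = f.
Proof.
apply/funext; elim=> [|j w IH]; rewrite /mul_gen /= ?subr0 ?addr0 //.
by case: eqP => _; rewrite ?IH ?addrK // subr0 addr0.
Qed.

Lemma mul_letterK a f : mul_letter a (mul_letter (linv a) f) = f.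
Proof. by case: a => i []; rewrite /mul_letter /= ?mul_genK ?mul_gen_invK. Qed.

Definition act g f : seq 'I_n -> int := foldr mul_letter f (free_word g).

Lemma foldr_cons_letter a u f :
  foldr mul_letter f (cons_letter a u) = mul_letter a (foldr mul_letter f u).
Proof.
by case: u => [|b u] //=; case: eqP => [->|//] /=; rewrite mul_letterK.
Qed.

Lemma actM g h f : act (g * h)%g f = act g (act h f).
Proof.
rewrite /act /=; elim: (free_word g) => //= a u IH.
by rewrite foldr_cons_letter IH.
Qed.

Lemma act_gen i f : act (free_gen i) f = mul_gen i f.
Proof. by []. Qed.

Definition delta w : int := (w == [::])%:R.

Definition magnus g : seq 'I_n -> int := act g delta.

Lemma mul_genB i f f' : mul_gen i (f - f') = mul_gen i f - mul_gen i f'.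
Proof.
apply/funext => -[|j w]; rewrite /mul_gen !fctE; first by rewrite !addr0.
by case: eqP => _; rewrite ?addr0 // opprD addrACA.
Qed.

Lemma mul_gen_invB i f f' :
  mul_gen_inv i (f - f') = mul_gen_inv i f - mul_gen_inv i f'.
Proof.
by rewrite -{1}[f](mul_genK i) -{1}[f'](mul_genK i) -mul_genB mul_gen_invK.
Qed.

Lemma actB g f f' : act g (f - f') = act g f - act g f'.
Proof.
rewrite /act; elim: (free_word g) => //= -[i []] u ->.
  exact: mul_gen_invB.
exact: mul_genB.
Qed.

Lemma magnus_nil g : magnus g [::] = 1.
Proof.
rewrite /magnus /act; elim: (free_word g) => [//|[i []] u IH] /=.
  by rewrite /mul_letter /= IH subr0.
by rewrite /mul_letter /= /mul_gen IH addr0.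
Qed.

End MagnusAction.

HB.instance Definition _ n (g : free_group n) :=
  GRing.isZmodMorphism.Build _ _ (act g) (actB g).

(** * Evaluating Magnus series in filtered modules *)

Section Universality.
Variables (n : nat) (M : zmodType) (T : free_group n -> {additive M -> M}).
Variable L : nat -> M -> Prop.
Hypothesis T1 : forall v, T 1%g v = v.
Hypothesis TM : forall g h v, T (g * h)%g v = T g (T h v).
Hypothesis L_mono : forall s v, L s.+1 v -> L s v.
Hypothesis L0 : forall s, L s 0.
Hypothesis LB : forall s u v, L s u -> L s v -> L s (u - v).
Hypothesis LT : forall s i v, L s v -> L s.+1 (T (free_gen i) v - v).
Implicit Types (f : seq 'I_n -> int) (v : M).

Let D i v := T (free_gen i) v - v.

Let DB i u v : D i (u - v) = D i u - D i v.
Proof. by rewrite /D raddfB !opprD addrACA. Qed.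

Let DD i u v : D i (u + v) = D i u + D i v.
Proof. by rewrite /D raddfD opprD addrACA. Qed.

Let LD s u v : L s u -> L s v -> L s (u + v).
Proof.
by move=> Lu Lv; rewrite -[v]opprK -[- v]sub0r; do 2!apply: LB => //.
Qed.

(* The value at v of the series sum_w f(w) (x_{w_1} - 1) ... (x_{w_k} - 1),
   truncated to words of length less than K. *)
Fixpoint magnus_eval K f v : M :=
  if K is K'.+1 then
    v *~ f [::] + \sum_i D i (magnus_eval K' (fun w => f (i :: w)) v)
  else 0.

Lemma magnus_evalD K f f' v :
  magnus_eval K (fun w => f w + f' w) v = magnus_eval K f v + magnus_eval K f'
    v.
Proof.
elim: K f f' => [|K IH] f f' /=; first by rewrite addr0.
rewrite mulrzDr addrACA -big_split /=; congr (_ + _); apply: eq_bigr => i _.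
by rewrite IH /D raddfD opprD addrACA.
Qed.

Lemma magnus_eval0 K v : magnus_eval K (fun _ => 0) v = 0.
Proof.
elim: K => //= K IH; rewrite mulr0z add0r big1 // => i _.
by rewrite IH /D raddf0 subrr.
Qed.

Lemma magnus_eval_mul_gen K i f v :
  magnus_eval K.+1 (mul_gen i f) v
  = magnus_eval K.+1 f v + D i (magnus_eval K f v).
Proof.
rewrite /= /mul_gen addr0 -addrA; congr (_ + _).
rewrite (bigD1 i) //= [in RHS](bigD1 i) //= eqxx magnus_evalD DD addrAC.
congr (_ + _ + _); apply: eq_bigr => j /negPf ji; rewrite ji;
  congr (D _ (magnus_eval _ _ _)).
by apply/funext => w; rewrite addr0.
Qed.

(** Each [T (free_gen i) - 1] raises the level by one, so words of length at least [K] contribute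
    only to level [K]. *)
Lemma magnus_evalP g K v :
  (forall h, L 0 (T h v)) -> L K (T g v - magnus_eval K (magnus g) v).
Proof.
move=> Lv; have Lv0 h : L 0 (T h v - 0) by rewrite subr0.
elim/free_group_ind: g K => [|i g IH|i g IH] [|K]; try exact: Lv0.
- rewrite T1 /= mulr1z opprD addrA subrr sub0r -sub0r.
  apply: LB => //; rewrite big1 // => i _.
  have -> : (fun w => magnus 1%g (i :: w)) = (fun _ => 0) by apply/funext.
  by rewrite magnus_eval0 /D raddf0 subrr.
- have -> : magnus (free_gen i * g)%g = mul_gen i (magnus g).
    by rewrite /magnus actM.
  rewrite magnus_eval_mul_gen TM -(subrK (T g v) (T (free_gen i) _)).
  rewrite [_ + D _ _]addrC opprD addrACA -DB addrC.
  by apply: LD; [exact: IH | apply/LT/IH].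
set h := (_^-1 * g)%g.
(* As g = x_i h, the error for [h] at order k+1 is the error for [g] minus x_i - 1 applied to the
   error for [h] at order k; hence the inner induction. *)
have IHh : forall K, L K (T h v - magnus_eval K (magnus h) v).
  elim=> [|k IHk]; first exact: Lv0.
  have Eg : g = (free_gen i * h)%g by rewrite /h mulKVg.
  have := IH k.+1; rewrite {1 2}Eg {1}/magnus actM act_gen -/(magnus h).
  rewrite magnus_eval_mul_gen TM -(subrK (T h v) (T (free_gen i) _)).
  rewrite [_ + D _ _]addrC opprD addrACA -DB => /LB/(_ (LT i IHk)).
  by rewrite addrAC subrr add0r.
exact: IHh.
Qed.

Variable p : nat.
Hypothesis Lp : forall s v, L s (v *+ p).

Lemma magnus_eval_dvd K f v s :
    (forall w, (size w < K)%N -> (p %| f w)%Z) -> L s (magnus_eval K f v).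
Proof.
elim: K f s => [|K IH] f s pf //=; apply: LD.
  have /dvdzP[c ->] := pf [::] isT.
  by rewrite mulrzA -pmulrn; exact: Lp.
elim/big_ind: _ => [//|*|i _]; first exact: LD.
by apply/L_mono/LT/IH => w wK; apply: pf.
Qed.

(** Multiples of [p] lie in every level, so modulo level [K] only the constant term 1 of the series
    survives. *)
Lemma magnus_eval_depth g K v : (forall h, L 0 (T h v)) ->
    (forall w, (0 < size w < K)%N -> (p %| magnus g w)%Z) ->
  L K (T g v - v).
Proof.
move=> Lv pg; have := magnus_evalP g K Lv.
case: K pg => [|K] pg /=; first by move=> _; rewrite -{2}[v]T1; apply: LB.
rewrite magnus_nil mulr1z opprD addrA => /LD;
  rewrite -[X in _ -> L _ X]/(_ - _).
move=> /(_ (\sum_i D i (magnus_eval K (fun w => magnus g (i :: w)) v))).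
rewrite subrK; apply; elim/big_ind: _ => [//|*|i _]; first exact: LD.
by apply/LT/magnus_eval_dvd => w wK; apply: pg.
Qed.

End Universality.

(** * Depth modulo p under endomorphisms *)

Section Depth.
Variables (n p : nat).
Implicit Types (f : seq 'I_n -> int) (g : free_group n) (w : seq 'I_n).

Definition dvd_below s f : Prop :=
  forall w, (size w < s)%N -> (p %| f w)%Z.

Lemma dvd_below0 s : dvd_below s 0.
Proof. by move=> w _; rewrite dvdz0. Qed.

Lemma dvd_belowD s f f' : dvd_below s f -> dvd_below s f' -> dvd_below s (f +
  f').
Proof. by move=> df df' w ws; rewrite rpredD ?df ?df'. Qed.

Lemma dvd_belowB s f f' : dvd_below s f -> dvd_below s f' -> dvd_below s (f -
  f').
Proof. by move=> df df' w ws; rewrite rpredB ?df ?df'. Qed.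

Lemma dvd_below_letter s a f :
  dvd_below s f -> dvd_below s.+1 (mul_letter a f - f).
Proof.
case: a => i e df.
have dinv w : (size w < s)%N -> (p %| mul_gen_inv i f w)%Z.
  elim: w => [|j w IH] ws /=; first by rewrite subr0 df.
  by rewrite rpredB ?df //; case: ifP => _; rewrite ?dvdz0 // IH // ltnW.
move=> w ws; rewrite !fctE /mul_letter /=.
by case: e; case: w ws => [|j w] ws /=;
  rewrite /mul_gen /= ?subr0 ?addr0 ?subrr //
  addrAC subrr add0r; case: ifP => _; rewrite ?oppr0 ?dvdz0 ?rpredN ?df ?dinv.
Qed.

Lemma dvd_below_act s g f : dvd_below s f -> dvd_below s.+1 (act g f - f).
Proof.
move=> df; rewrite /act.
elim: (free_word g) => [|a u IH] /=; first by rewrite subrr; exact: dvd_below0.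
rewrite -(subrK (foldr (@mul_letter n) f u) (mul_letter a _)) -addrA.
apply: dvd_belowD (IH); apply: dvd_below_letter.
rewrite -(subrK f (foldr _ _ _)); apply: dvd_belowD (df).
by move=> w ws; apply: IH; apply: ltnW.
Qed.

(** Let [h] act on power series through [phi h], filtered by [dvd_below]. Every Magnus series begins
    with 1, so generators raise the level, and [magnus_eval_depth] applies to the series 1. *)
Lemma magnus_dvd_endo r (phi : free_group n -> free_group n) g :
    {morph phi : x y / (x * y)%g} -> phi 1%g = 1%g ->
    (forall w, (0 < size w < r)%N -> (p %| magnus g w)%Z) ->
  forall w, (0 < size w < r)%N -> (p %| magnus (phi g) w)%Z.
Proof.
move=> phiM phi1 pg w /andP[w0 wr].
pose T h : {additive (seq 'I_n -> int) -> (seq 'I_n -> int)} := act (phi h).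
have TM h k f : T (h * k)%g f = T h (T k f) by rewrite /T phiM /= actM.
have T1 f : T 1%g f = f by rewrite /T phi1.
have LT s i f : dvd_below s f -> dvd_below s.+1 (T (free_gen i) f - f).
  exact: dvd_below_act.
have L_mono s f : dvd_below s.+1 f -> dvd_below s f.
  by move=> df u us; apply: df; apply: ltnW.
have Lp s f : dvd_below s (f *+ p).
  by move=> u _; rewrite natmulfctE -mulr_natr natz dvdz_mull.
have Lv h : dvd_below 0 (T h (@delta n)) by [].
have := magnus_eval_depth T1 TM L_mono dvd_below0 dvd_belowB LT Lp Lv pg.
by move/(_ w wr); rewrite !fctE /= {2}/delta -size_eq0 eqn0Ngt w0 subr0.
Qed.

End Depth.

(** * A Magnus coefficient prime to p *)

Section MagnusNontrivial.
Variable n : nat.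
Implicit Types (f : seq 'I_n -> int) (w : seq 'I_n).

Lemma mul_letter_neq (a : letter n) f w :
  ohead w != Some a.1 -> mul_letter a f w = f w.
Proof.
case: a => i []; case: w => [|j w];
  rewrite /mul_letter /= ?/mul_gen ?subr0 ?addr0 //;
  by rewrite (inj_eq (@Some_inj _)) => /negPf->; rewrite ?subr0 ?addr0.
Qed.

Lemma mul_letter_eq (a : letter n) f w : ohead w != Some a.1 ->
  mul_letter a f (a.1 :: w) = f (a.1 :: w) + (-1) ^+ a.2 * f w.
Proof.
move=> aw; rewrite /mul_letter; case: ifP => ea /=;
  rewrite ?/mul_gen eqxx ?mul1r //.
have := mul_letter_neq f aw; rewrite /mul_letter ea => ->.
by rewrite expr1 mulN1r.
Qed.

Definition alternating : pred (seq 'I_n) := sorted (fun i j => i != j).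

(** This kills the unwanted term when a new syllable starts on the left. *)
Definition alternating_vanish i w f :=
  forall v, v != [::] -> alternating (rcons v i) -> f (v ++ i :: w) = 0.

Lemma alternating_vanish_letter (a : letter n) f w :
  alternating_vanish a.1 w f -> alternating_vanish a.1 w (mul_letter a f).
Proof.
move=> f0 [|k v] // _ altv.
have [ak|ka] := eqVneq k a.1; last by rewrite mul_letter_neq // f0.
rewrite {k}ak in altv *; case: v altv => [|k v] /=; first by rewrite eqxx.
case/andP=> ak altv; rewrite mul_letter_eq //= 1?eq_sym //.
rewrite (f0 (a.1 :: k :: v)) ?(f0 (k :: v)) ?mulr0 ?addr0 //=.
by rewrite /alternating /= ak.
Qed.

Lemma letter_eq (a b : letter n) : b != linv a -> a.1 = b.1 -> a = b.
Proof. by case: a b => [i []] [j []] ba /= ij; rewrite ij ?eqxx // in ba *. Qed.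

Lemma dvdz_sign_mul p (s : bool) e (m : int) : prime p -> (0 < e < p)%N ->
  (p %| (-1) ^+ s * e%:R * m)%Z = (p %| m)%Z.
Proof.
move=> p_pr /andP[e0 ep]; rewrite !dvdzE !abszM abszX exp1n mul1n.
by rewrite natz !absz_nat Euclid_dvdM // gtnNdvd.
Qed.

(** Cut the word into syllables, the maximal powers of one generator. The coefficient at the word of
    syllable generators is, up to sign, the product of the syllable lengths, all below [p]. Here
    [a.1 :: w] is that word and [e] the length of the first syllable, kept apart because it can
    still grow. *)
Lemma magnus_skeleton p (a : letter n) (u : seq (letter n)) :
    prime p -> (size u < p.-1)%N -> reduced (a :: u) ->
  let f := foldr (@mul_letter n) (@delta n) (a :: u) in
  exists w e,
    [/\ alternating_vanish a.1 w f, ohead w != Some a.1, ~~ (p %| f w)%Z,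
        (0 < e <= (size u).+1)%N & f (a.1 :: w) = (-1) ^+ a.2 * e%:R * f w].
Proof.
move=> p_pr; have p1 := prime_gt1 p_pr.
elim: u a => [|b u IH] a up ru f.
  exists [::], 1%N; split=> //.
  - by apply: alternating_vanish_letter => -[].
  - by rewrite /f /= mul_letter_neq // /delta eqxx dvdz1 absz_nat neq_ltn p1
    orbT.
  - rewrite /f /= mul_letter_eq // mul_letter_neq // add0r mulr1.
    exact: esym (mulr1 _).
have [w [e [f0 bw pw /andP[e0 eu] fbw]]] := IH b (ltnW up) (reduced_tail ru).
move: ru => /andP[ba _]; rewrite {}/f.
rewrite -[foldr _ _ (a :: _)]/(mul_letter a (foldr (@mul_letter n) (@delta n)
  (b :: u))).
set f := foldr _ _ (b :: u) in f0 pw fbw *.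
(* Adjacent letters of a reduced word on the same generator are equal, so the first syllable grows
   by one; otherwise a syllable of length one begins. *)
have [ab|ab] := eqVneq a.1 b.1.
  rewrite {a ab ba up}(letter_eq ba ab).
  exists w, e.+1; rewrite mul_letter_neq // mul_letter_eq // fbw.
  split=> //; first exact: alternating_vanish_letter.
  by rewrite -[e.+1]addn1 natrD mulrDr mulrDl mulr1.
have abw : ohead (b.1 :: w) != Some a.1.
  by rewrite /=; apply: contraNneq ab => -[->].
exists (b.1 :: w), 1%N; rewrite mul_letter_neq // mul_letter_eq //; split=> //.
- apply: alternating_vanish_letter => v v0 altv.
  have := f0 (rcons v a.1); rewrite -cats1 -catA /=; apply.
    by rewrite -size_eq0 size_cat addn1.
  case: v altv {v0} => [|k v]; first by rewrite /alternating /= ab.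
  by rewrite /alternating /= !cats1 !rcons_path last_rcons => ->.
- rewrite fbw dvdz_sign_mul // e0 (leq_ltn_trans eu) //.
  exact: leq_trans up (leq_pred p).
- by rewrite (f0 [:: a.1]) ?mulr1 ?add0r //; rewrite /alternating /= ab.
Qed.

Lemma magnus_nontrivial p (g : free_group n) :
    prime p -> (size (free_word g) < p)%N -> g <> 1%g ->
  exists2 w, w != [::] & ~~ (p %| magnus g w)%Z.
Proof.
case: g => -[|a u] ru p_pr up g1; first by case: g1; apply: val_inj.
have [|w [e [_ aw pw /andP[e0 eu] fw]]] := magnus_skeleton p_pr _ ru.
  by rewrite ltn_predRL.
exists (a.1 :: w) => //; rewrite [magnus _ _]fw.
by rewrite dvdz_sign_mul // e0 (leq_ltn_trans eu).
Qed.

(** Take [r] least for [x]. Endomorphisms never lower the depth; applied to an automorphism and to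
    its inverse, this makes it constant on the orbit. *)
Lemma magnus_depth p (x : free_group n) :
    prime p -> (size (free_word x) < p)%N -> x <> 1%g ->
  exists2 r, (0 < r)%N & forall y, aut_orbit x y ->
    (forall w, (0 < size w < r)%N -> (p %| magnus y w)%Z) /\
    (exists2 w, size w = r & ~~ (p %| magnus y w)%Z).
Proof.
move=> p_pr xp x1; have [w0 w0n pw0] := magnus_nontrivial p_pr xp x1.
pose P r := `[< exists2 w, (0 < size w <= r)%N & ~~ (p %| magnus x w)%Z >].
have exP : exists r, P r.
  exists (size w0); apply/asboolP; exists w0 => //.
  by rewrite lt0n size_eq0 w0n leqnn.
case: (ex_minnP exP) => r /asboolP[w /andP[w_gt0 wr] pw] min_r.
have px v : (0 < size v < r)%N -> (p %| magnus x v)%Z.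
  case/andP=> v0 vr; apply: contraTT vr => pv; rewrite -leqNgt; apply: min_r.
  by apply/asboolP; exists v; rewrite ?v0 ?leqnn.
have r0 : (0 < r)%N by apply: leq_trans wr.
exists r => // y [phi [psi phiK psiK] <-{y}].
have phiM : {morph phi : y z / (y * z)%g} by move=> y z; rewrite gmulfM.
have phi1 : phi 1%g = 1%g by rewrite gmulf1.
have psiM : {morph psi : y z / (y * z)%g} := can2_gmulfM phiK psiK.
have psi1 : psi 1%g = 1%g := can2_gmulf1 phiK psiK.
have py v : (0 < size v < r)%N -> (p %| magnus (phi x) v)%Z.
  exact: (magnus_dvd_endo phiM phi1 px).
split=> //; apply: contrapT => Nex.
move/negP: pw; apply; rewrite -[x]phiK.
apply: (@magnus_dvd_endo n p r.+1 psi) => //; last by rewrite w_gt0.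
move=> v /andP[v0]; rewrite ltnS leq_eqVlt => /orP[/eqP vr|vr];
  last by rewrite py ?v0.
by apply: contrapT => /negP pv; apply: Nex; exists v.
Qed.

End MagnusNontrivial.

(** * Generic points of finite fields *)

Section GenericPoint.
Variable p : nat.
Hypothesis p_pr : prime p.

(* A field too large for the finitely many nonzero polynomials of size at most
   D over the prime field to kill all its elements. *)
Lemma exists_generic_point D (F : finFieldType) :
    p \in [pchar F] -> (p ^ D * D < #|F|)%N ->
  exists theta : F, forall P : {poly int}, (size P <= D)%N ->
    (exists i, ~~ (p %| P`_i)%Z) -> (map_poly intr P).[theta] != 0 :> F.
Proof.
move=> pF cardF.
pose R (v : {ffun 'I_D -> 'I_p}) : {poly F} :=
  \poly_(i < D) (if insub i is Some j then (v j)%:R else 0).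
pose Q := \prod_(v | R v != 0) R v.
have Q0 : Q != 0 by apply/prodf_neq0.
have sQ : (size Q <= (p ^ D * D).+1)%N.
  apply: leq_trans (size_prod_leq _ _) _; apply: leq_trans (leq_subr _ _) _.
  rewrite ltnS; apply: leq_trans (_ : (\sum_(v : {ffun 'I_D -> 'I_p}) D <=
    _)%N).
    rewrite [X in (_ <= X)%N](bigID (fun v => R v != 0)) /=.
    by apply: leq_trans (leq_addr _ _); apply: leq_sum => v _; apply: size_poly.
  by rewrite sum_nat_const card_ffun !card_ord.
have [theta Qtheta] : exists theta, ~~ root Q theta.
  apply: contrapT => noroot; suff : (#|F| < size Q)%N.
    by rewrite ltnNge (leq_trans sQ).
  rewrite cardE; apply: max_poly_roots (enum_uniq F) => //.
  apply/allP => theta _; apply: contrapT => /negP tQ; apply: noroot.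
  by exists theta.
exists theta => P sP [i pPi].
pose v := [ffun i : 'I_D => Ordinal (ltn_pmod `|(P`_i %% p)%Z|%N (prime_gt0
  p_pr))].
have PR : map_poly intr P = R v.
  apply/polyP => k; rewrite coef_map_id0 // coef_poly.
  case: ltnP => [kD|Dk]; last by rewrite nth_default // (leq_trans sP).
  rewrite insubT ffunE /=.
  have Dk : `|(P`_k %% p)%Z|%N%:Z = (P`_k %% p)%Z.
    by rewrite gez0_abs // modz_ge0 // -lt0n prime_gt0.
  rewrite modn_small; last by rewrite -ltz_nat Dk ltz_pmod ?ltz_nat ?prime_gt0.
  rewrite pmulrn Dk {1}(divz_eq P`_k p) rmorphD rmorphM /= -pmulrn.
  by rewrite (pcharf0 pF) mulr0 add0r.
have Rv0 : R v != 0.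
  rewrite -PR; apply: contraNneq pPi => /polyP/(_ i).
  by rewrite coef0 coef_map_id0 // (dvdz_pcharf pF) => ->.
move: Qtheta; rewrite PR rootE horner_prod => /prodf_neq0; exact.
Qed.

(** The degree over the prime field is a power of [p] so that a p-power of a matrix can produce a
    full norm. *)
Lemma exists_finField D : exists (F : finFieldType) (j : nat) (theta : F),
  [/\ p \in [pchar F], (0 < j)%N, #|F| = (p ^ (p ^ j))%N &
   forall P : {poly int}, (size P <= D)%N ->
    (exists i, ~~ (p %| P`_i)%Z) -> (map_poly intr P).[theta] != 0 :> F].
Proof.
pose j := (p ^ D * D).+1; have p1 := prime_gt1 p_pr.
have pj : (0 < p ^ j)%N by rewrite expn_gt0 prime_gt0.
have [F pF cF] := pPrimePowerField p_pr pj.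
exists F, j; have [|theta ?] := @exists_generic_point D F pF.
  by rewrite cF; apply: ltn_trans (ltnSn _) (ltn_trans (ltn_expl j p1)
    (ltn_expl _ p1)).
by exists theta; split.
Qed.

(** The multiples of 1 already give p roots of X^p - X, so no further root exists. *)
Lemma prime_subfield (F : fieldType) (c : F) : p \in [pchar F] -> c ^+ p = c ->
  exists m, c = m%:R.
Proof.
move=> pF cp; apply: contrapT => Nex; have p1 := prime_gt1 p_pr.
pose s := c :: [seq m%:R | m <- iota 0 p].
pose q : {poly F} := 'X^p - 'X.
have size_q : size q = p.+1.
  by rewrite size_polyDl size_polyXn // size_polyN size_polyX ltnS.
have : (size s < size q)%N.
  apply: max_poly_roots.
  - by rewrite -size_poly_gt0 size_q.
  - rewrite /= rootE !hornerE cp subrr eqxx /=.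
    apply/allP => _ /mapP[m _ ->]; rewrite rootE !hornerE.
    by rewrite -[_ ^+ p](pFrobenius_autE pF) pFrobenius_aut_nat subrr.
  rewrite /s /=; apply/andP; split.
    by apply/mapP => -[m _ cm]; apply: Nex; exists m.
  rewrite map_inj_in_uniq ?iota_uniq // => a b.
  rewrite !mem_iota /= !add0n => ap bp /eqP.
  wlog ab : a b ap bp / (a <= b)%N.
    move=> W; case: (leqP a b) => [/W|/ltnW ba E]; first exact.
    by apply/esym/W => //; rewrite eq_sym.
  rewrite eq_sym -subr_eq0 -natrB // -(dvdn_pcharf pF) => pab.
  apply/eqP; rewrite eqn_leq ab -subn_eq0 eqn0Ngt;
    apply/negP => /dvdn_leq/(_ pab).
  by rewrite leqNgt (leq_ltn_trans (leq_subr _ _)).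
by rewrite size_q /= size_map size_iota ltnn.
Qed.
End GenericPoint.

(** * Unipotent representations *)

Section WordPoly.
Variables (n : nat).
Hypothesis n_gt0 : (0 < n)%N.
Implicit Types (f : seq 'I_n -> int).

(* The sum of f w X^k over words w of length K, where w lists the base-n digits
   of k. *)
Fixpoint word_poly K f : {poly int} :=
  if K is K'.+1 then
    \sum_(i < n) 'X^i * (word_poly K' (fun w => f (i :: w)) \Po 'X^n)
  else (f [::])%:P.

(** The exponents in the i-th summand are congruent to i modulo n, so summands do not overlap and
    nothing cancels. *)
Lemma coef_word_polyS K f (i : 'I_n) k :
  (word_poly K.+1 f)`_(k * n + i) = (word_poly K (fun w => f (i :: w)))`_k.
Proof.
rewrite /= coef_sum (bigD1 i) //= coefXnM ltnNge leq_addl addnK /=.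
rewrite coef_comp_poly_Xn // dvdn_mull // mulnK // big1 ?addr0 // => j ji.
rewrite coefXnM; case: ltnP => // jk; rewrite coef_comp_poly_Xn //.
case: ifP => // /dvdnP[q E]; case/negP: ji; apply/eqP/val_inj => /=.
have /(congr1 (modn^~ n)) : (k * n + i = q * n + j)%N by rewrite -E subnK.
by rewrite /= !modnMDl !modn_small.
Qed.

Lemma size_word_poly K f : (size (word_poly K f) <= n ^ K)%N.
Proof.
apply/leq_sizeP => k.
elim: K f k => [|K IH] f k nk; first by rewrite coefC gtn_eqF.
rewrite (divn_eq k n) (coef_word_polyS _ f (Ordinal (ltn_pmod k n_gt0))).
by apply: IH; rewrite leq_divRL // -expnSr.
Qed.

Lemma word_poly_ndvd p f w : ~~ (p %| f w)%Z ->
  exists k, ~~ (p %| (word_poly (size w) f)`_k)%Z.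
Proof.
elim: w f => [|i w IH] f pf; first by exists 0%N; rewrite coefC.
have [k pk] := IH (fun w => f (i :: w)) pf.
by exists (k * n + i)%N; rewrite [size _]/= coef_word_polyS.
Qed.

End WordPoly.

(** * Matrices filtered by superdiagonals *)

Section UpperTriangular.
Variables (F : fieldType) (m : nat).
Implicit Types A B : 'M[F]_m.+1.

Definition upper_level s A := forall a b : 'I_m.+1, (b < a + s)%N -> A a b = 0.

Lemma upper_level0 s : upper_level s 0.
Proof. by move=> a b _; rewrite mxE. Qed.

Lemma upper_level1 : upper_level 0 1.
Proof.
by move=> a b; rewrite addn0 mxE => ba; rewrite -val_eqE (gtn_eqF ba).
Qed.

Lemma upper_levelB s A B :
  upper_level s A -> upper_level s B -> upper_level s (A - B).
Proof. by move=> lA lB a b ab; rewrite !mxE lA ?lB ?subrr. Qed.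

Lemma upper_levelD s A B :
  upper_level s A -> upper_level s B -> upper_level s (A + B).
Proof. by move=> lA lB a b ab; rewrite !mxE lA ?lB ?addr0. Qed.

Lemma upper_levelW s t A : (s <= t)%N -> upper_level t A -> upper_level s A.
Proof. by move=> st lA a b ab; apply/lA/(leq_trans ab); rewrite leq_add2l. Qed.

Lemma upper_levelM s t A B :
  upper_level s A -> upper_level t B -> upper_level (s + t) (A *m B).
Proof.
move=> lA lB a b ab; rewrite mxE big1 // => c _.
case: (ltnP c (a + s)) => ac; first by rewrite lA ?mul0r.
by rewrite lB ?mulr0 // (leq_trans ab) // addnA leq_add2r.
Qed.

Lemma upper_levelX s A k : upper_level s A -> upper_level (s * k) (A ^+ k).
Proof.
move=> lA; elim: k => [|k IH]; first by rewrite muln0; exact: upper_level1.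
by rewrite exprSr mulnS addnC; apply: upper_levelM.
Qed.

Lemma upper_level_gt s A : (m < s)%N -> upper_level s A -> A = 0.
Proof.
move=> ms lA; apply/matrixP => a b; rewrite mxE lA //.
by rewrite (leq_trans (ltn_ord b)) // (leq_trans ms) ?leq_addl.
Qed.

(** Each factor moves the index right by at least [s], so the only path of k steps from 0 to [s * k]
    visits the multiples of [s]. *)
Lemma upper_level_diag s A k : upper_level s A -> (s * k <= m)%N ->
  (A ^+ k) ord0 (inord (s * k)) =
    \prod_(b < k) A (inord (s * b)) (inord (s * b + s)).
Proof.
move=> lA; elim: k => [|k IH] km.
  by rewrite big_ord0 muln0 mxE -val_eqE /= inordK.
have km' : (s * k <= m)%N by apply: leq_trans km; rewrite leq_mul2l leqnSn orbT.
rewrite big_ord_recr exprSr mxE (bigD1 (inord (s * k))) //= IH //.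
rewrite mulnS addnC [X in _ + X]big1 ?addr0 // => c;
  rewrite -val_eqE /= inordK // neq_ltn.
case/orP => ck; first by rewrite (upper_levelX lA) ?mul0r.
rewrite [X in _ * X]lA ?mulr0 // inordK ?ltn_add2r //.
by rewrite -mulnSr ltnS.
Qed.

Variable p : nat.
Hypothesis pF : p \in [pchar F].

Lemma subr1X_pchar A k : (A - 1) ^+ (p ^ k) = A ^+ (p ^ k) - 1.
Proof.
have pM : p \in [pchar 'M[F]_m.+1] by rewrite pchar_lalg.
elim: k => [|k IH]; first by rewrite expn0 !expr1.
rewrite expnSr !exprM IH -[LHS](pFrobenius_autE pM).
by rewrite pFrobenius_autB_comm ?pFrobenius_aut1 //; apply: commr1.
Qed.

Lemma unipotentX A k : (m < p ^ k)%N -> upper_level 1 (A - 1) -> A ^+ (p ^ k) =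
  1.
Proof.
move=> mk lA; apply/eqP; rewrite -subr_eq0 -subr1X_pchar; apply/eqP.
apply: (@upper_level_gt (1 * p ^ k)); first by rewrite mul1n.
  exact: upper_levelX.
Qed.

Lemma unipotentM A B :
  upper_level 1 (A - 1) -> upper_level 1 (B - 1) -> upper_level 1 (A *m B - 1).
Proof.
move=> lA lB.
have -> : A *m B - 1 = (A - 1) *m (B - 1) + ((A - 1) + (B - 1)).
  by rewrite addrA mulmxBr mulmx1 subrK mulmxBl mul1mx addrA subrK.
apply: upper_levelD; last exact: upper_levelD.
by apply: (@upper_levelW _ 2) => //; apply: (@upper_levelM 1 1).
Qed.

End UpperTriangular.

(** * Unitriangular representations and their leading superdiagonal *)

Section UnipotentRep.
Variables (n m p : nat) (F : fieldType) (t : 'I_n -> nat -> F).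
Hypotheses (p_pr : prime p) (pF : p \in [pchar F]).
Implicit Types (f : seq 'I_n -> int) (g : free_group n).

Definition shift_mx i : 'M[F]_m.+1 :=
  \matrix_(a, b) (t i a *+ (b == a.+1 :> nat)).

Lemma shift_mx_level i : upper_level 1 (shift_mx i).
Proof. by move=> a b; rewrite mxE addn1 => ba; rewrite (ltn_eqF ba). Qed.

Lemma shift_mulmx i (A : 'M[F]_m.+1) a b : (a < m)%N ->
  (shift_mx i *m A) (inord a) b = t i a * A (inord a.+1) b.
Proof.
move=> am; rewrite mxE (bigD1 (inord a.+1)) //= big1 => [|c].
  by rewrite addr0 mxE !inordK ?ltnS ?(ltnW am) // eqxx.
rewrite -val_eqE /= inordK // mxE inordK; last exact: ltnW.
by move/negPf->; rewrite mul0r.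
Qed.

Lemma shift_unit i : 1 + shift_mx i \in unitmx.
Proof.
have mp : (m < p ^ m)%N by apply/ltn_expl/prime_gt1.
rewrite -[_ \in _](unitrX_pos _ (n := p ^ m)) ?(leq_trans _ mp) //.
rewrite (unipotentX pF mp) ?unitr1 // addrC addKr; exact: shift_mx_level.
Qed.

Definition unipotent_rep : group_hom (free_group n) (GL m.+1 F) :=
  free_lift (fun i => GLMatrix (shift_unit i)).

Let psi g : 'M[F]_m.+1 := GL_mx (unipotent_rep g).

Lemma unipotent_rep_gen i : psi (free_gen i) = 1 + shift_mx i.
Proof.
exact: mulmx1.
Qed.

Lemma unipotent_repM g h : psi (g * h)%g = psi g *m psi h.
Proof. by rewrite /psi gmulfM. Qed.

Lemma unipotent_rep1 : psi 1%g = 1.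
Proof. by rewrite /psi gmulf1. Qed.

Lemma unipotent_repX g k : psi (g ^+ k)%g = psi g ^+ k.
Proof.
elim: k => [|k IH]; first exact: unipotent_rep1.
by rewrite expgS unipotent_repM IH exprS.
Qed.

Lemma unipotent_rep_level g : upper_level 1 (psi g - 1).
Proof.
have gen i : upper_level 1 (psi (free_gen i) - 1).
  by rewrite unipotent_rep_gen addrC addKr; exact: shift_mx_level.
elim/free_group_ind: g => [|i g IH|i g IH].
- by rewrite unipotent_rep1 subrr; apply: upper_level0.
- by rewrite unipotent_repM; apply: unipotentM.
have mp : (m < p ^ m)%N by apply/ltn_expl/prime_gt1.
have p0 : (0 < p ^ m)%N by apply: leq_trans mp.
(* Generators have p-power order, so an inverse is a nonnegative power and closure under products
   suffices. *)
have V : psi (free_gen i)^-1%g = psi (free_gen i) ^+ (p ^ m).-1.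
  rewrite -[LHS]mulr1 -(unipotentX pF mp (gen i)) -{1}(prednK p0) exprS mulrA.
  by rewrite -[_ * psi (free_gen i)]unipotent_repM mulVg unipotent_rep1 mul1r.
rewrite unipotent_repM V; apply: unipotentM => //.
elim: (p ^ m).-1 => [|k IHk].
  by rewrite expr0 subrr; apply: upper_level0.
by rewrite exprS; apply: unipotentM.
Qed.

(** The contribution of words of length [K] to the entry in row [a], column [a + K]: each letter is
    one step along the superdiagonal. *)
Fixpoint word_value K f a : F :=
  if K is K'.+1 then
    \sum_i t i a * word_value K' (fun w => f (i :: w)) a.+1
  else (f [::])%:~R.

Let T g : {additive 'M[F]_m.+1 -> 'M[F]_m.+1} := mulmx (psi g).

Let D i (A : 'M[F]_m.+1) : T (free_gen i) A - A = shift_mx i *m A.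
Proof. by rewrite /T /= unipotent_rep_gen mulmxDl mul1mx addrC addKr. Qed.

(** A product of k shift matrices is supported on the k-th superdiagonal, so shorter words miss this
    entry. *)
Lemma magnus_eval_entry K f a : (a + K <= m)%N ->
  magnus_eval T K.+1 f 1 (inord a) (inord (a + K)) = word_value K f a.
Proof.
elim: K f a => [|K IH] f a aK.
  rewrite addn0 in aK *; rewrite /= big1 ?addr0 => [|i _].
    by rewrite -scaler_int !mxE eqxx mulr1.
  by rewrite raddf0 subrr.
have -> : magnus_eval T K.+2 f 1 = 1 *~ f [::]
    + \sum_i (shift_mx i *m magnus_eval T K.+1 (fun w => f (i :: w)) 1).
  by congr (_ + _); apply: eq_bigr => i _; rewrite D.
have ne : (inord a == inord (a + K.+1) :> 'I_m.+1) = false.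
  rewrite -val_eqE /= !inordK ?ltnS ?(leq_trans (leq_addr _ _) aK) //.
  by rewrite -[X in X == _]addn0 eqn_add2l.
rewrite mxE -scaler_int mxE mxE ne mulr0 add0r summxE; apply: eq_bigr => i _.
rewrite shift_mulmx; last by rewrite (leq_trans _ aK) // addnS ltnS leq_addr.
by rewrite -addSnnS IH // addSnnS.
Qed.

(** Evaluate the Magnus series on matrices filtered by [upper_level]; at order [r.+1] the error
    vanishes in the entry [(a, a + r)]. *)
Lemma unipotent_rep_depth g r : (0 < r)%N ->
    (forall w, (0 < size w < r)%N -> (p %| magnus g w)%Z) ->
  upper_level r (psi g - 1) /\
  forall a, (a + r <= m)%N ->
    (psi g - 1) (inord a) (inord (a + r)) = word_value r (magnus g) a.
Proof.
move=> r0 pg.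
have T1 v : T 1%g v = v by rewrite /T /= unipotent_rep1 mul1mx.
have TM h k v : T (h * k)%g v = T h (T k v).
  by rewrite /T /= unipotent_repM mulmxA.
have L_mono s (A : 'M[F]_m.+1) : upper_level s.+1 A -> upper_level s A.
  exact: upper_levelW.
have L0 s := @upper_level0 F m s.
have LB s := @upper_levelB F m s.
have LT s i (A : 'M[F]_m.+1) :
    upper_level s A -> upper_level s.+1 (T (free_gen i) A - A).
  by rewrite D => lA; apply: upper_levelM (@shift_mx_level i) lA.
have Lp s (A : 'M[F]_m.+1) : upper_level s (A *+ p).
  by rewrite -scaler_nat (pcharf0 pF) scale0r.
have Lv h : upper_level 0 (T h 1).
  rewrite /T /= mulmx1 -[psi h](subrK 1); apply: upper_levelD;
    last exact: upper_level1.
  exact: upper_levelW (@unipotent_rep_level h).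
split.
  have := magnus_eval_depth T1 TM L_mono L0 LB LT Lp Lv pg.
  by rewrite /T /= mulmx1.
move=> a am.
have := magnus_evalP T1 TM L0 LB LT g r.+1 Lv.
have ar : (a < a + r)%N by rewrite -[X in (X < _)%N]addn0 ltn_add2l.
move/(_ (inord a) (inord (a + r))).
rewrite !inordK ?ltnS ?(leq_trans (leq_addr _ _) am) // addnS ltnS leqnn.
move=> /(_ isT)/eqP; rewrite /T /= mulmx1 mxE mxE subr_eq0 => /eqP E.
have E1 : (1 : 'M[F]_m.+1) (inord a) (inord (a + r)) = 0.
  rewrite mxE -val_eqE /= !inordK ?ltnS ?(leq_trans (leq_addr _ _) am) //.
  by rewrite (ltn_eqF ar).
by rewrite mxE [X in _ + X]mxE E1 subr0 E magnus_eval_entry.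
Qed.

End UnipotentRep.

(** * Norms in the upper right corner *)

Section NormPower.
Variables (n p j r : nat) (F : finFieldType) (theta : F).
Hypotheses (n_gt0 : (0 < n)%N) (p_pr : prime p) (pF : p \in [pchar F]).
Hypotheses (cardF : #|F| = (p ^ (p ^ j))%N) (r_gt0 : (0 < r)%N).
Hypothesis theta_generic : forall P : {poly int}, (size P <= n ^ r)%N ->
  (exists i, ~~ (p %| P`_i)%Z) -> (map_poly intr P).[theta] != 0 :> F.

(* The superdiagonal consists of p ^ j blocks of length r, each the image of the
   previous one under Frobenius. *)
Definition digit_power (i : 'I_n) (a : nat) : F :=
  theta ^+ (i * n ^ (a %% r)) ^+ (p ^ (a %/ r)).

(** The offset [l] multiplies all digit weights by n^l, and block [b] applies Frobenius [b] times,
    which fixes the integer coefficients. General [l] serves the induction. *)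
Lemma word_value_poly k (f : seq 'I_n -> int) b l : (l + k <= r)%N ->
  word_value digit_power k f (r * b + l)
    = (map_poly intr (word_poly k f)).[theta ^+ (n ^ l)] ^+ (p ^ b).
Proof.
have pb : [pchar F].-nat (p ^ b)%N by rewrite pnatX (eq_pnat _ (pcharf_eq pF))
  pnat_id.
elim: k f l => [|k IH] f l lr /=.
  rewrite map_polyC hornerC /= -[LHS]/((f [::])%:~R).
  elim: b {lr pb} => [|b IH]; first by rewrite expr1.
  rewrite expnSr exprM -IH -[RHS](pFrobenius_autE pF).
  by rewrite rmorph_int.
rewrite addnS in lr.
have lr' : (l < r)%N by apply: leq_ltn_trans lr; apply: leq_addr.
rewrite rmorph_sum horner_sum /=.
rewrite (big_morph (fun z => z ^+ (p ^ b)) (id1 := 0) (op1 := +%R)); first last.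
- by rewrite expr0n expn_eq0 -leqn0 leqNgt prime_gt0.
- by move=> u v; rewrite exprDn_pchar.
apply: eq_bigr => i _; rewrite -addnS IH ?addSn // rmorphM hornerM exprMn.
rewrite rmorphXn /= map_polyX hornerXn map_comp_poly horner_comp map_polyXn
  hornerXn.
rewrite /digit_power [(r * b)%N]mulnC modnMDl modn_small // divnMDl //
  divn_small // addn0.
by rewrite -!exprM -mulnA mulnCA expnSr.
Qed.

Let m := (r * p ^ j)%N.

Let psi (g : free_group n) : 'M[F]_m.+1 :=
  GL_mx (unipotent_rep m digit_power p_pr pF g).

(** The p^j-th power of [psi y - 1] survives only in the corner, as the product of the Frobenius
    conjugates of [al]: a nonzero norm, hence in the prime field. *)
Lemma unipotent_rep_norm y :
    (forall w, (0 < size w < r)%N -> (p %| magnus y w)%Z) ->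
    (exists2 w, size w = r & ~~ (p %| magnus y w)%Z) ->
  exists2 c, ~~ (p %| c)%N &
    psi (y ^+ (p ^ j))%g = 1 + delta_mx ord0 ord_max *+ c.
Proof.
move=> py [w wr pw].
have [lev entry] := unipotent_rep_depth m digit_power p_pr pF r_gt0 py.
rewrite -/(psi y) in lev entry.
set al := (map_poly intr (word_poly r (magnus y))).[theta] : F.
have al0 : al != 0.
  apply: theta_generic; first exact: size_word_poly.
  by rewrite -wr; apply: word_poly_ndvd.
pose c0 := \prod_(b < p ^ j) al ^+ (p ^ b).
have c0_neq0 : c0 != 0 by apply/prodf_neq0 => b _; rewrite expf_neq0.
(* Frobenius permutes the factors cyclically, since the power of [al] with exponent [#|F|] is
   [al]. *)
have c0p : c0 ^+ p = c0.
  rewrite /c0 -prodrXl -(big_mkord xpredT (fun b => al ^+ (p ^ b))).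
  rewrite -(big_mkord xpredT (fun b => al ^+ (p ^ b) ^+ p)).
  under eq_bigr => b _ do rewrite -exprM -expnSr.
  have N0 : (0 < p ^ j)%N by rewrite expn_gt0 prime_gt0.
  rewrite -(prednK N0) big_nat_recr // big_nat_recl //= prednK //.
  by rewrite -cardF expf_card expn0 expr1 mulrC.
have [c cE] := prime_subfield p_pr pF c0p.
exists c; first by rewrite (dvdn_pcharf pF) -cE.
rewrite [psi _]unipotent_repX -/(psi y); apply/eqP.
rewrite addrC -subr_eq -subr1X_pchar //; apply/eqP/matrixP => a b.
rewrite mulmxnE !mxE.
have [ab|] := boolP ((a == ord0) && (b == ord_max)); last first.
  rewrite mul0rn => ab; apply: (upper_levelX lev).
  rewrite ltnNge; apply: contra ab => mab.
  have bm := ltn_ord b; rewrite ltnS in bm.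
  have am : (a + m <= m)%N := leq_trans mab bm.
  apply/andP; split; first by rewrite -val_eqE /= -leqn0 -(leq_add2r m).
  by rewrite -val_eqE /= eqn_leq bm (leq_trans (leq_addl a m) mab).
case/andP: ab => /eqP-> /eqP->.
have -> : ord_max = inord m :> 'I_m.+1 by apply: val_inj; rewrite /= inordK.
rewrite upper_level_diag // -cE /c0; apply: eq_bigr => k _.
rewrite entry -1?mulnSr ?leq_mul2l ?ltn_ord ?orbT //.
by rewrite -[(r * k)%N]addn0 word_value_poly // expn0 expr1.
Qed.

End NormPower.

(** * Permutation matrices of a linear action *)

Section PermutationRep.
Variables (F : finFieldType) (m : nat).
Implicit Types A B : 'M[F]_m.

Definition perm_rep A : 'M[int]_#|'rV[F]_m| :=
  \matrix_(a, b) (enum_val a *m A == enum_val b)%:R.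

Lemma perm_rep1 : perm_rep 1%:M = 1%:M.
Proof.
by apply/matrixP => a b; rewrite !mxE mulmx1 (inj_eq enum_val_inj).
Qed.

Lemma perm_repM A B : perm_rep (A *m B) = perm_rep A *m perm_rep B.
Proof.
apply/matrixP => a b; rewrite !mxE.
rewrite (bigD1 (enum_rank (enum_val a *m A))) //= !mxE enum_rankK eqxx mul1r.
rewrite mulmxA big1 ?addr0 // => c ca; rewrite mxE; case: eqP => [E|];
  last first.
  by rewrite mul0r.
by rewrite E enum_valK eqxx in ca.
Qed.

Lemma perm_rep_inj : injective perm_rep.
Proof.
move=> A B AB; apply/row_matrixP => i; rewrite !rowE.
have /matrixP/(_ (enum_rank (delta_mx 0 i)) (enum_rank (delta_mx 0 i *m A))) :=
  AB.
by rewrite !mxE !enum_rankK eqxx; case: eqP.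
Qed.

End PermutationRep.

(** * Representations without fixed vectors *)

Section RepData.
Variable n : nat.
Implicit Types (x y g : free_group n).

(* The invariant sublattice V is encoded as the image of E, so that no basis of V
   is needed. *)
Definition rep_data d (s : free_group n -> 'M[int]_d) (E : 'M[int]_d) M :=
  [/\ s 1%g = 1%:M, {morph s : g h / (g * h)%g >-> g *m h},
      (0 < M)%N /\ (forall g, s (g ^+ M)%g = 1%:M),
      E != 0 & forall g, E *m s g = s g *m E].

(* A power of y acts on the image of E as an element of order p without fixed
   vectors, and so do the powers of that power with exponent coprime to p. *)
Definition no_fixed_vector d (s : free_group n -> 'M[int]_d) (E : 'M[int]_d) M
  y :=
  exists p e, [/\ prime p, (p %| M)%N, (0 < e)%N &
    forall c, coprime p c -> E *m (\sum_(j < p) s (y ^+ (e * c * j))%g) = 0].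

(** The sum is fixed by [Z ^+ a], hence by [Z], which is a power of [Z ^+ a] because [a] is
    invertible modulo [p]. *)
Lemma norm_of_root_of_unity (R : pzRingType) (Z : R) p a :
  Z ^+ p = 1 -> coprime p a -> (1 - Z) * (\sum_(j < p) Z ^+ (a * j)) = 0.
Proof.
move=> Zp pa; set T := \sum_(j < p) _.
have aT : Z ^+ a * T = T.
  rewrite /T mulr_sumr; case: p Zp {pa T} => [|p] Zp;
    first by rewrite !big_ord0.
  rewrite big_ord_recr [RHS]big_ord_recl /= muln0 expr0 addrC; congr (_ + _).
    by rewrite -exprD -mulnS mulnC exprM Zp expr1n.
  by apply: eq_bigr => j _; rewrite -exprD -mulnS.
have akT k : Z ^+ (k * a) * T = T.
  elim: k => [|k IH]; first by rewrite mul1r.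
  by rewrite mulSn exprD -mulrA IH.
(* This exponent is 1 modulo [p] and divisible by [a]. *)
have Z1 : Z = Z ^+ chinese p a 1 0.
  rewrite [in RHS](divn_eq (chinese p a 1 0) p) (chinese_modl pa 1 0).
  rewrite exprD mulnC exprM Zp expr1n mul1r.
  case: p Zp {pa T aT akT} => [|[|p]] Zp; first by rewrite modn0 expr1.
    by rewrite modnn expr0 -[LHS]expr1.
  by rewrite modn_small ?expr1.
have /dvdnP[k Ek] : (a %| chinese p a 1 0)%N.
  by rewrite /dvdn (chinese_modr pa 1 0) mod0n.
by rewrite mulrBl mul1r {1}Z1 Ek akT subrr.
Qed.

(** Centrality of [z] makes [1 - perm_rep z] commute with the action, and [y ^+ (p ^ j)] acts as a
    power of [z] with exponent prime to [p], so [norm_of_root_of_unity] applies. *)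
Lemma rep_of_prime x p : (0 < n)%N -> prime p -> (size (free_word x) < p)%N ->
    x <> 1%g ->
  exists d (s : free_group n -> 'M[int]_d) E k, rep_data s E (p ^ k) /\
    forall y, aut_orbit x y -> no_fixed_vector s E (p ^ k) y.
Proof.
move=> n0 p_pr xp x1; have p1 := prime_gt1 p_pr.
have [r r0 depth] := magnus_depth p_pr xp x1.
have [F [j [theta [pF j0 cardF gen]]]] := exists_finField p_pr (n ^ r).
set m := (r * p ^ j)%N.
have m0 : (0 < m)%N by rewrite muln_gt0 r0 expn_gt0 prime_gt0.
pose psi g : 'M[F]_m.+1 := GL_mx (unipotent_rep m (digit_power p r theta) p_pr
  pF g).
pose dl : 'M[F]_m.+1 := delta_mx ord0 ord_max.
have dl_level : upper_level m dl.
  move=> a b ab; rewrite mxE; case: eqP => //= a0; case: eqP => //= bm.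
  by rewrite a0 bm ltnn in ab.
have level0 (A : 'M[F]_m.+1) : upper_level m.+1 A -> A = 0.
  exact: upper_level_gt.
have psi1 g : upper_level 1 (psi g - 1) by apply: unipotent_rep_level.
have dl_psi g : dl *m psi g = dl.
  apply/eqP; rewrite -subr_eq0 -{2}[dl]mulmx1 -mulmxBr; apply/eqP/level0.
  by move: (upper_levelM dl_level (psi1 g)); rewrite [(m + 1)%N]addn1.
have psi_dl g : psi g *m dl = dl.
  apply/eqP; rewrite -subr_eq0 -{2}[dl]mul1mx -mulmxBl; apply/eqP/level0.
  exact: (upper_levelM (psi1 g) dl_level).
have dl2 : dl * dl = 0.
  apply: upper_level_gt (upper_levelM dl_level dl_level).
  by rewrite -[X in (X < _)%N]addn0 ltn_add2l.
pose z := 1 + dl.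
have zX c : z ^+ c = 1 + dl *+ c.
  elim: c => [|c IH]; first by rewrite addr0.
  by rewrite exprSr IH mulrDl mul1r mulrDr mulr1 mulrnAl dl2 mul0rn addr0
    -addrA -mulrS.
have zp : z ^+ p = 1.
  by rewrite zX -scaler_nat (pcharf0 pF) scale0r addr0.
have repX (A : 'M[F]_m.+1) c : perm_rep (A ^+ c) = perm_rep A ^+ c.
  elim: c => [|c IH]; first exact: perm_rep1.
  by rewrite !exprS -IH; exact: perm_repM.
have mp : (m < p ^ m.+1)%N by apply: ltn_trans (ltnSn m) (ltn_expl _ p1).
exists _, (fun g => perm_rep (psi g)), (1%:M - perm_rep z), m.+1; split.
  split.
  - by rewrite [psi _]unipotent_rep1 -[1]/1%:M perm_rep1.
  - by move=> g h; rewrite -perm_repM -[psi (g * h)%g]/(psi _) [psi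
    _]unipotent_repM.
  - split=> [|g]; first by rewrite expn_gt0 prime_gt0.
    rewrite [psi _]unipotent_repX -/(psi g) (unipotentX pF mp) //.
    exact: perm_rep1.
  - rewrite subr_eq0 -perm_rep1; apply/eqP => /perm_rep_inj/eqP.
    rewrite eq_sym -subr_eq0 /z addrC addKr => /eqP/matrixP.
    by move=> /(_ ord0 ord_max)/eqP; rewrite !mxE !eqxx oner_eq0.
  - move=> g; rewrite mulmxBl mulmxBr mul1mx mulmx1 -!perm_repM /z.
    by rewrite mulmxDl mulmxDr mul1mx mulmx1 dl_psi psi_dl.
move=> y /depth[py ypow].
have [c pc yN] := unipotent_rep_norm n0 p_pr pF cardF r0 gen py ypow.
exists p, (p ^ j)%N; split=> //; first by rewrite expnS dvdn_mulr.
  by rewrite expn_gt0 prime_gt0.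
move=> a pa.
have -> : \sum_(i < p) perm_rep (psi (y ^+ (p ^ j * a * i))%g)
    = \sum_(i < p) perm_rep z ^+ (c * a * i).
  apply: eq_bigr => i _; rewrite -!repX -mulnA expgM [psi _]unipotent_repX.
  by rewrite yN -/dl -zX -exprM mulnA.
apply: norm_of_root_of_unity; first by rewrite -repX zp; exact: perm_rep1.
by rewrite coprimeMr pa andbT prime_coprime.
Qed.

(** * Tensor products of representations with coprime periods *)

Lemma tensmx11 d1 d2 : (1%:M : 'M[int]_d1) *t (1%:M : 'M[int]_d2) = 1%:M.
Proof.
apply/matrixP => a b; case: (mxtens_indexP a) => i j;
  case: (mxtens_indexP b) => k l.
rewrite tensmxE !mxE (inj_eq (can_inj (@mxtens_indexK _ _))) xpair_eqE.
by case: (i == k); rewrite ?mul1r ?mul0r.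
Qed.

Lemma tensmx_suml d1 d2 (I : finType) (A : I -> 'M[int]_d1) (B : 'M[int]_d2) :
  \sum_i (A i *t B) = (\sum_i A i) *t B.
Proof.
apply/matrixP => a b; rewrite summxE !mxE summxE mulr_suml.
by apply: eq_bigr => i _; rewrite !mxE.
Qed.

Lemma tensmx_sumr d1 d2 (I : finType) (A : 'M[int]_d1) (B : I -> 'M[int]_d2) :
  \sum_i (A *t B i) = A *t (\sum_i B i).
Proof.
apply/matrixP => a b; rewrite summxE !mxE summxE mulr_sumr.
by apply: eq_bigr => i _; rewrite !mxE.
Qed.

Lemma matrix_neq0 (d1 d2 : nat) (A : 'M[int]_(d1, d2)) :
  A != 0 -> exists i j, A i j != 0.
Proof.
move=> A0; apply: contrapT => nex; case/negP: A0; apply/eqP/matrixP => i j.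
by rewrite mxE; apply/eqP; apply: contrapT => /negP Aij; apply: nex;
  exists i, j.
Qed.

Lemma rep_data_tens d1 d2 (s1 : free_group n -> 'M[int]_d1)
    (s2 : free_group n -> 'M[int]_d2) E1 E2 M1 M2 :
    rep_data s1 E1 M1 -> rep_data s2 E2 M2 ->
  rep_data (fun g => s1 g *t s2 g) (E1 *t E2) (M1 * M2).
Proof.
move=> [s11 s1M [M10 s1X] E10 E1C] [s21 s2M [M20 s2X] E20 E2C].
split.
- by rewrite s11 s21 tensmx11.
- by move=> g h; rewrite s1M s2M tensmx_mul.
- split=> [|g]; first by rewrite muln_gt0 M10.
  have -> : s1 (g ^+ (M1 * M2))%g = 1%:M by rewrite mulnC expgM s1X.
  by rewrite expgM s2X tensmx11.
- have [[i [j Eij]] [k [l Ekl]]] := (matrix_neq0 E10, matrix_neq0 E20).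
  apply/eqP => /matrixP/(_ (mxtens_index (i, k)) (mxtens_index (j, l)))/eqP.
  by rewrite tensmxE mxE mulf_eq0 (negPf Eij) (negPf Ekl).
- by move=> g; rewrite !tensmx_mul E1C E2C.
Qed.

(** The factor [M2] in the exponent trivialises [s2] and leaves the sum for [s1] with [c] replaced
    by [M2 * c], still prime to [p]; this is why [no_fixed_vector] quantifies over [c]. *)
Lemma no_fixed_vector_tensl d1 d2 (s1 : free_group n -> 'M[int]_d1)
    (s2 : free_group n -> 'M[int]_d2) E1 E2 M1 M2 y :
    rep_data s2 E2 M2 -> coprime M1 M2 -> no_fixed_vector s1 E1 M1 y ->
  no_fixed_vector (fun g => s1 g *t s2 g) (E1 *t E2) (M1 * M2) y.
Proof.
move=> [_ _ [M20 s2X] _ _] M12 [p [e [p_pr pM e0 kill]]].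
exists p, (e * M2)%N; split=> //; rewrite ?dvdn_mulr ?muln_gt0 ?e0 // => c pc.
under eq_bigr => j _.
  have -> : s2 (y ^+ (e * M2 * c * j))%g = 1%:M.
    by rewrite -!mulnA mulnCA mulnC expgM s2X.
  rewrite -[(e * M2 * c)%N]mulnA.
  over.
rewrite tensmx_suml tensmx_mul kill ?tens0mx //.
by rewrite coprimeMr pc andbT (coprime_dvdl pM).
Qed.

Lemma no_fixed_vector_tensr d1 d2 (s1 : free_group n -> 'M[int]_d1)
    (s2 : free_group n -> 'M[int]_d2) E1 E2 M1 M2 y :
    rep_data s1 E1 M1 -> coprime M1 M2 -> no_fixed_vector s2 E2 M2 y ->
  no_fixed_vector (fun g => s1 g *t s2 g) (E1 *t E2) (M1 * M2) y.
Proof.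
move=> [_ _ [M10 s1X] _ _] M12 [p [e [p_pr pM e0 kill]]].
exists p, (e * M1)%N; split=> //; rewrite ?dvdn_mull ?muln_gt0 ?e0 // => c pc.
under eq_bigr => j _.
  have -> : s1 (y ^+ (e * M1 * c * j))%g = 1%:M.
    by rewrite -!mulnA mulnCA mulnC expgM s1X.
  rewrite -[(e * M1 * c)%N]mulnA.
  over.
rewrite tensmx_sumr tensmx_mul kill ?tensmx0 //.
by rewrite coprimeMr pc andbT coprime_sym (coprime_dvdr pM).
Qed.

Lemma rep_of_seq (l : seq (free_group n)) : (0 < n)%N -> 1%g \notin l ->
  exists d (s : free_group n -> 'M[int]_d) E M, rep_data s E M /\
    forall x y, x \in l -> aut_orbit x y -> no_fixed_vector s E M y.
Proof.
move=> n0; elim: l => [_|x l IH].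
  exists 1%N, (fun=> 1%:M), 1%:M, 1%N; split=> //; split=> // [g h|].
    by rewrite mulmx1.
  exact: oner_neq0.
rewrite in_cons negb_or => /andP[x1 /IH[d2 [s2 [E2 [M2 [rd2 nf2]]]]]].
(* Exceeding [M2] makes the periods coprime; exceeding the length of [x] gives a Magnus coefficient
   prime to [p]. *)
have [p] := prime_above (maxn M2 (size (free_word x))).
rewrite gtn_max => /andP[pM px] p_pr.
have x1' : x <> 1%g by apply/eqP; rewrite eq_sym.
have [d1 [s1 [E1 [k [rd1 nf1]]]]] := rep_of_prime n0 p_pr px x1'.
have M20 : (0 < M2)%N by case: rd2 => _ _ [].
have cop : coprime (p ^ k) M2 by rewrite coprimeXl // prime_coprime // gtnNdvd.
exists _, (fun g => s1 g *t s2 g), (E1 *t E2), (p ^ k * M2)%N.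
split; first exact: rep_data_tens.
move=> x' y; rewrite in_cons => /orP[/eqP->|x'l] xy.
  by apply: no_fixed_vector_tensl => //; apply: nf1.
by apply: no_fixed_vector_tensr => //; apply: nf2 xy.
Qed.

End RepData.

(** * Affine representations *)

Lemma mulrn_mx_eq0 a b (A : 'M[int]_(a, b)) k : A *+ k = 0 -> (0 < k)%N -> A =
  0.
Proof.
move=> /matrixP Ak k0; apply/matrixP => i j; have /eqP := Ak i j.
by rewrite mulmxnE !mxE Num.Theory.mulrn_eq0 -leqn0 leqNgt k0 => /eqP.
Qed.

Section AffineRep.
Variables (n d : nat) (s : free_group n -> 'M[int]_d) (c : 'I_n -> 'cV[int]_d).
Hypotheses (s1 : s 1%g = 1%:M) (sM : {morph s : g h / (g * h)%g >-> g *m h}).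
Implicit Types g : free_group n.

Definition affine_mx (A : 'M[int]_d) (v : 'cV[int]_d) : 'M[int]_(d + 1) :=
  block_mx A v 0 1%:M.

Lemma affine_mxM A v B w :
  affine_mx A v *m affine_mx B w = affine_mx (A *m B) (A *m w + v).
Proof.
by rewrite /affine_mx mulmx_block !mulmx0 !mul0mx !mulmx1 !addr0 !add0r.
Qed.

Lemma affine_mx1 : affine_mx 1%:M 0 = 1%:M.
Proof. by rewrite /affine_mx -scalar_mx_block. Qed.

Definition affine_gen i := affine_mx (s (free_gen i)) (c i).

Definition affine_gen_inv i :=
  affine_mx (s (free_gen i)^-1%g) (- (s (free_gen i)^-1%g *m c i)).

Lemma affine_genV i : affine_gen_inv i *m affine_gen i = 1%:M.
Proof. by rewrite affine_mxM -sM mulVg s1 subrr affine_mx1. Qed.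

Lemma affine_gen_unit i : affine_gen i \in unitmx.
Proof. by have [] := mulmx1_unit (affine_genV i). Qed.

Definition affine_rep : group_hom (free_group n) (GL (d + 1) int) :=
  free_lift (fun i => GLMatrix (affine_gen_unit i)).

Lemma affine_rep_gen i : GL_mx (affine_rep (free_gen i)) = affine_gen i.
Proof. exact: mulmx1. Qed.

Lemma affine_repM g (h : free_group n) :
  GL_mx (affine_rep (g * h)%g) = GL_mx (affine_rep g) *m GL_mx (affine_rep h).
Proof. by rewrite gmulfM. Qed.

Lemma affine_rep1 : GL_mx (affine_rep 1%g) = 1%:M.
Proof. by rewrite gmulf1. Qed.

Lemma affine_repV i : GL_mx (affine_rep (free_gen i)^-1%g) = affine_gen_inv i.
Proof.
rewrite -[LHS]mul1mx -(affine_genV i) -mulmxA -affine_rep_gen -affine_repM.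
by rewrite mulgV affine_rep1 mulmx1.
Qed.

Lemma affine_repX g v k : GL_mx (affine_rep g) = affine_mx (s g) v ->
  GL_mx (affine_rep (g ^+ k)%g)
    = affine_mx (s (g ^+ k)%g) ((\sum_(j < k) s (g ^+ j)%g) *m v).
Proof.
move=> gv; elim: k => [|k IH].
  by rewrite big_ord0 mul0mx affine_rep1 s1 affine_mx1.
by rewrite expgSr affine_repM IH gv affine_mxM -sM big_ord_recr mulmxDl addrC.
Qed.

Variables (E : 'M[int]_d) (M : nat).
Hypotheses (M_gt0 : (0 < M)%N) (sX : forall g, s (g ^+ M)%g = 1%:M).
Hypothesis E_comm : forall g, E *m s g = s g *m E.
Hypothesis cE : forall i, exists u, c i = E *m u.

(** The image of [E] is invariant because [E] commutes with [s], so it contains all translation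
    parts once it contains those of the generators. *)
Lemma affine_repP g : exists u, GL_mx (affine_rep g) = affine_mx (s g) (E *m u).
Proof.
elim/free_group_ind: g => [|i g [u IH]|i g [u IH]].
- by exists 0; rewrite affine_rep1 s1 mulmx0 affine_mx1.
- have [w cw] := cE i; exists (s (free_gen i) *m u + w).
  rewrite affine_repM affine_rep_gen IH affine_mxM -sM cw mulmxDr.
  by rewrite !mulmxA E_comm.
- have [w cw] := cE i; exists (s (free_gen i)^-1%g *m (u - w)).
  rewrite affine_repM affine_repV IH affine_mxM -sM cw.
  by rewrite [X in _ = affine_mx _ X]mulmxA E_comm -mulmxA !mulmxBr.
Qed.

(** The p-th power of [y ^+ e] has zero translation part by the norm identity; the M-th power then
    removes the linear part. *)
Lemma affine_rep_torsion y : no_fixed_vector s E M y -> finite_order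
  (affine_rep y).
Proof.
move=> [p [e [p_pr pM e0 kill]]]; exists (e * p * M)%N.
  by rewrite !muln_gt0 e0 prime_gt0.
rewrite -gmulfXn; apply: val_inj; rewrite /= !expgM.
have [u hu] := affine_repP (y ^+ e)%g.
have /= hp := affine_repX p hu.
have k0 : (\sum_(j < p) s ((y ^+ e) ^+ j)%g) *m (E *m u) = 0.
  have := kill 1%N (coprimen1 p); under eq_bigr => j _ do rewrite muln1 expgM.
  rewrite mulmxA mulmx_suml; under [X in _ -> X *m _ = _]eq_bigr => j _ do
    rewrite -E_comm.
  by rewrite -mulmx_sumr => ->; rewrite mul0mx.
rewrite k0 in hp; have := affine_repX M hp.
by rewrite mulmx0 sX affine_mx1.
Qed.

(* A finite image would have a fixed point, the sum S of the translation parts. *)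
Lemma affine_rep_infinite i0 i1 : no_fixed_vector s E M (free_gen i0) ->
  c i0 = 0 -> c i1 <> 0 -> infinite_set (range affine_rep).
Proof.
move=> [p [e [p_pr pM e0 kill]]] c0 c1 /finite_seqP[L rL].
pose l := undup L.
have inl (h : GL (d + 1) int) : reflect (exists g, affine_rep g = h) (h \in l).
  rewrite mem_undup; apply: (iffP idP) => [hL|[g <-]].
    have : [set` L]%classic h by [].
    by rewrite -rL => -[g _ <-]; exists g.
  have : range affine_rep (affine_rep g) by exists g.
  by rewrite rL.
pose tr (h : GL (d + 1) int) : 'cV[int]_d := ursubmx (GL_mx h).
pose S := \sum_(h <- l) tr h.
(* Left multiplication by a generator permutes the image; reindex the sum. *)
have fixS i : S = s (free_gen i) *m S + c i *+ size l.
  have lP : perm_eq [seq (affine_rep (free_gen i) * h)%g | h <- l] l.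
    apply: uniq_perm; rewrite ?undup_uniq // ?map_inj_uniq ?undup_uniq //.
      exact: mulgI.
    move=> h; apply/mapP/inl => [[_ /inl[g <-] ->]|[g <-]].
      by exists (free_gen i * g)%g; rewrite gmulfM.
    exists (affine_rep ((free_gen i)^-1 * g)%g); last by rewrite -gmulfM mulKVg.
    by apply/inl; eexists.
  rewrite {1}/S -(perm_big _ lP) /= big_map.
  have trM (h : GL (d + 1) int) : h \in l ->
      tr (affine_rep (free_gen i) * h)%g = s (free_gen i) *m tr h + c i.
    case/inl=> g <-; have [u gu] := affine_repP g.
    have -> : tr (affine_rep g) = E *m u by rewrite /tr gu block_mxKur.
    rewrite -gmulfM /tr affine_repM affine_rep_gen gu affine_mxM.
    by rewrite block_mxKur.
  rewrite big_seq (eq_bigr _ trM) -big_seq big_split -mulmx_sumr.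
  by rewrite big_const_seq count_predT iter_addr_0.
have [U SU] : exists U, S = E *m U.
  rewrite /S big_seq; elim/big_rec: _ => [|h v /inl[g <-] [U ->]].
    by exists 0; rewrite mulmx0.
  have [u gu] := affine_repP g; exists (u + U).
  by rewrite /tr gu block_mxKur mulmxDr.
(* [S] lies in the image of [E] and is fixed by [s (free_gen i0)], so the norm identity reads p S =
   0. *)
have S0 : S = 0.
  have sS k : s (free_gen i0 ^+ k)%g *m S = S.
    elim: k => [|k IH]; first by rewrite s1 mul1mx.
    by rewrite expgS sM -mulmxA IH {2}(fixS i0) c0 mul0rn addr0.
  have := congr1 (fun A => A *m U) (kill 1%N (coprimen1 p)).
  rewrite mul0mx mulmx_sumr mulmx_suml.
  under eq_bigr => j _ do rewrite E_comm -mulmxA -SU sS.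
  rewrite sumr_const card_ord => /mulrn_mx_eq0; apply; exact: prime_gt0.
apply: c1; have := fixS i1; rewrite S0 mulmx0 add0r => /esym/mulrn_mx_eq0;
  apply.
rewrite lt0n size_eq0; apply/eqP => l0.
by have /inl : exists g, affine_rep g = affine_rep 1%g by [exists 1%g];
  rewrite l0.
Qed.

End AffineRep.

(** * Choice of orbits and of a cocycle *)

Local Open Scope classical_set_scope.

Theorem theorem6 (n : nat) (hn : (2 <= n)%N) (X : set (free_group n))
    (hX : exists2 S : set (free_group n), finite_set S &
            X `<=` \bigcup_(x in S) aut_orbit x) :
  exists (d : nat) (rho : group_hom (free_group n) (GL d int)),
    [/\ (1 <= d)%N,
        infinite_set (range rho) &
        forall A : GL d int, (rho @` X) A -> finite_order A].
Proof.
have n0 : (0 < n)%N := ltnW hn.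
have [S /finite_seqP[L SL] XS] := hX.
pose i0 := Ordinal n0; pose i1 := Ordinal hn.
(* The generator is added to force an infinite image; the orbit of the identity is trivial and
   handled apart. *)
pose l := free_gen i0 :: [seq x <- L | x != 1%g].
have l1 : 1%g \notin l.
  by rewrite in_cons mem_filter eqxx.
have [d [s [E [M [[s1 sM [M0 sX] E0 E_comm] nf]]]]] := rep_of_seq n0 l1.
have [k [j Ekj]] := matrix_neq0 E0.
(* The translation at [i1] is a nonzero column of [E]; it vanishes at [i0], which differs from
   [i1]. *)
pose c i : 'cV[int]_d := if i == i1 then E *m delta_mx j 0 else 0.
have cE i : exists u, c i = E *m u.
  by rewrite /c; case: eqP => _; [exists (delta_mx j 0) | exists 0;
    rewrite mulmx0].
exists (d + 1)%N, (affine_rep c s1 sM); split; first by rewrite addn1.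
- apply: (affine_rep_infinite E_comm cE (i0 := i0) (i1 := i1)).
  + by apply: (nf (free_gen i0)); rewrite ?mem_head //; exists idfun.
  + by rewrite /c.
  + rewrite /c eqxx => /matrixP/(_ k 0); rewrite -colE !mxE.
    exact/eqP.
- move=> _ [y /XS[x Sx xy] <-].
  have [x1|x1] := eqVneq x 1%g.
    case: xy => phi _; rewrite x1 gmulf1 => <-; rewrite gmulf1.
    by exists 1%N.
  apply: (affine_rep_torsion s1 sM M0 sX E_comm cE); apply: nf xy.
  by rewrite in_cons mem_filter x1 orbC; move: Sx; rewrite SL /= => ->.
Qed.
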